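(* The loxodromes $d\lambda=\cot\alpha\,\dfrac{d\varphi}{\cos\varphi}$ are the only spherical curves (with $z$ non-constant, up to rotations around the $z$-axis) with spherical angular momentum $\mathcal K(\varphi)=-\cos\alpha\cos\varphi$, $\alpha\in(0,\pi/2)$.
   Context: $\mathbb{S}^2\subset\mathbb{R}^3$ is the unit sphere centred at the origin, with geographical coordinates latitude $\varphi$ and longitude $\lambda$, so that a spherical curve, parametrized by arc length $s$, is $\xi=(x,y,z)=(\cos\varphi\cos\lambda,\cos\varphi\sin\lambda,\sin\varphi)$; a dot denotes the derivative with respect to $s$. The spherical angular momentum of $\xi$ with respect to the $z$-axis is $\mathcal K=-\det(\xi,\dot\xi,(0,0,1))=\dot x\,y-x\,\dot y=-\dot\lambda\cos^2\varphi$, considered here as a function of $\varphi$ (equivalently of $z=\sin\varphi$). Loxodromes are the spherical curves defined by the equation $d\lambda=\cot\alpha\,d\varphi/\cos\varphi$, $\alpha\in(0,\pi/2)$.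
   Formalization: Uniqueness fails if z decreases (φ'=−sin α, λ'=cos α/cos φ has this K but is a mirror image): curves with this K are rotated loxodromes if z increases, equatorial mirror images of them if z decreases; loxodromes have this K when oriented with increasing latitude. *)

(* Defs.v *)
From Stdlib Require Import Reals.
From Coquelicot Require Import Coquelicot.
Open Scope R_scope.

Definition R3 : Type := (R * R * R)%type.

Definition cx (p : R3) : R := fst (fst p).
Definition cy (p : R3) : R := snd (fst p).
Definition cz (p : R3) : R := snd p.

Definition dot (p q : R3) : R := cx p * cx q + cy p * cy q + cz p * cz q.

Definition det3 (p q r : R3) : R :=
  cx p * (cy q * cz r - cz q * cy r)
  - cy p * (cx q * cz r - cz q * cx r)
  + cz p * (cx q * cy r - cy q * cx r).

Definition e3 : R3 := (0, 0, 1).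

Definition geo (phi lam : R) : R3 :=
  (cos phi * cos lam, cos phi * sin lam, sin phi).

Definition latitude (p : R3) : R := asin (cz p).

Definition rot_z (theta : R) (p : R3) : R3 :=
  (cos theta * cx p - sin theta * cy p,
   sin theta * cx p + cos theta * cy p,
   cz p).

Definition mirror_equator (p : R3) : R3 := (cx p, cy p, - cz p).

(* A curve is a total function R -> R3 of which only the restriction to an
   open interval (a, b), possibly unbounded, is meaningful. *)
Definition in_itv (a b : Rbar) (s : R) : Prop := Rbar_lt a s /\ Rbar_lt s b.

Definition velocity (xi : R -> R3) (s : R) : R3 :=
  (Derive (fun t => cx (xi t)) s,
   Derive (fun t => cy (xi t)) s,
   Derive (fun t => cz (xi t)) s).

Definition C1_at (f : R -> R) (s : R) : Prop :=
  ex_derive f s /\ continuous (Derive f) s.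

Definition arclength_spherical_curve (a b : Rbar) (xi : R -> R3) : Prop :=
  forall s, in_itv a b s ->
    dot (xi s) (xi s) = 1
    /\ C1_at (fun t => cx (xi t)) s
    /\ C1_at (fun t => cy (xi t)) s
    /\ C1_at (fun t => cz (xi t)) s
    /\ dot (velocity xi s) (velocity xi s) = 1.

Definition z_nonconstant (a b : Rbar) (xi : R -> R3) : Prop :=
  exists s t, in_itv a b s /\ in_itv a b t /\ cz (xi s) <> cz (xi t).

Definition z_increasing (a b : Rbar) (xi : R -> R3) : Prop :=
  forall s t, in_itv a b s -> in_itv a b t -> s < t -> cz (xi s) < cz (xi t).

Definition z_decreasing (a b : Rbar) (xi : R -> R3) : Prop :=
  forall s t, in_itv a b s -> in_itv a b t -> s < t -> cz (xi t) < cz (xi s).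

Definition angular_momentum (xi : R -> R3) (s : R) : R :=
  - det3 (xi s) (velocity xi s) e3.

Definition has_angular_momentum (a b : Rbar) (xi : R -> R3) (K : R -> R) : Prop :=
  forall s, in_itv a b s -> angular_momentum xi s = K (latitude (xi s)).

(* d(lam) = cot(alpha) d(phi) / cos(phi) along a differentiable determination
   (phi, lam) of the geographical coordinates.  The equation is independent of
   the orientation of the curve and of the additive constant in lam. *)
Definition loxodrome (alpha : R) (a b : Rbar) (xi : R -> R3) : Prop :=
  exists phi lam : R -> R, forall s, in_itv a b s ->
    - (PI / 2) < phi s < PI / 2
    /\ xi s = geo (phi s) (lam s)
    /\ ex_derive phi s
    /\ ex_derive lam s
    /\ Derive lam s = cos alpha / sin alpha * (Derive phi s / cos (phi s)).

(* The point of latitude phi on the loxodrome through (1, 0, 0). *)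
Definition loxodrome_point (alpha phi : R) : R3 :=
  geo phi (cos alpha / sin alpha * RInt (fun u => / cos u) 0 phi).

(* xi solves the loxodrome equation, and a single rotation around the z-axis
   carries the loxodrome through (1, 0, 0) onto it. *)
Definition rotated_loxodrome (alpha : R) (a b : Rbar) (xi : R -> R3) : Prop :=
  loxodrome alpha a b xi
  /\ exists theta, forall s, in_itv a b s ->
       xi s = rot_z theta (loxodrome_point alpha (latitude (xi s))).

(* Main.v *)
(* The identity |xi|^2 |xi'|^2 = 1 turns K = - cos alpha cos phi into
   z' = +- sin alpha cos phi.  The curve never reaches a pole: if xi(s0) is a pole,
   then (x, y) ~ (s - s0) (x'(s0), y'(s0)), so K = x' y - x y' is o(s - s0) by
   continuity of the velocity, whereas cos alpha cos phi is of exact order s - s0.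
   Hence z' has constant sign, and after a reflection in the equator phi' = sin alpha.
   Then (x, y) / cos phi turns at the rate cos alpha / cos phi, which is the
   derivative of cot alpha times the integral of 1 / cos at phi; so the longitude
   is this function up to a constant, i.e. up to one rotation about the z-axis. *)
Require Import Defs.
From Stdlib Require Import Reals Ranalysis5 Lra.
From Coquelicot Require Import Coquelicot.
Open Scope R_scope.

(** * Open intervals and functions without zeros on them *)

Lemma locally_in_itv (a b : Rbar) (s : R) :
  in_itv a b s -> locally s (in_itv a b).
Proof.
  intros [Ha Hb]; apply filter_and;
    [apply (open_Rbar_gt a s Ha) | apply (open_Rbar_lt b s Hb)].
Qed.

Lemma in_itv_between (a b : Rbar) (s t u : R) :
  in_itv a b s -> in_itv a b t -> s <= u <= t -> in_itv a b u.
Proof.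
  intros [Has _] [_ Htb] [Hsu Hut]; split.
  - now apply Rbar_lt_le_trans with (Finite s).
  - now apply Rbar_le_lt_trans with (Finite t).
Qed.

Lemma in_itv_two_points (a b : Rbar) :
  Rbar_lt a b -> exists s t, in_itv a b s /\ in_itv a b t /\ s < t.
Proof.
  destruct a as [a| |], b as [b| |]; simpl; intros Hab; try easy.
  - exists ((2 * a + b) / 3), ((a + 2 * b) / 3); unfold in_itv; simpl; lra.
  - exists (a + 1), (a + 2); unfold in_itv; simpl; lra.
  - exists (b - 2), (b - 1); unfold in_itv; simpl; lra.
  - exists 0, 1; unfold in_itv; simpl; lra.
Qed.

(** By the intermediate value theorem, two values of opposite sign would enclose a zero. *)
Lemma constant_sign_on_itv (a b : Rbar) (g : R -> R) :
  Rbar_lt a b ->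
  (forall s, in_itv a b s -> continuous g s) ->
  (forall s, in_itv a b s -> g s <> 0) ->
  (forall s, in_itv a b s -> 0 < g s) \/ (forall s, in_itv a b s -> g s < 0).
Proof.
  intros Hab Hcont Hne.
  assert (Hivt : forall (h : R -> R) s t,
             (forall u, in_itv a b u -> continuous h u) ->
             (forall u, in_itv a b u -> h u <> 0) ->
             in_itv a b s -> in_itv a b t -> s < t -> h s < 0 -> 0 < h t -> False).
  { intros h s t Hc Hn Hs Ht Hst Hneg Hpos.
    destruct (IVT_interv h s t) as [u [Hu Hzero]]; trivial.
    - intros u Hu; apply continuity_pt_filterlim, Hc.
      now apply in_itv_between with s t.
    - apply (Hn u); trivial; now apply in_itv_between with s t. }
  (* The two points may come in either order; the reversed order is [Hivt] for [- g]. *)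
  assert (Hopp : forall s t, in_itv a b s -> in_itv a b t ->
             g s < 0 -> 0 < g t -> False).
  { intros s t Hs Ht Hneg Hpos.
    destruct (Rtotal_order s t) as [Hst | [-> | Hst]]; [ | lra | ].
    - now apply (Hivt g s t).
    - apply (Hivt (fun u => - g u) t s); trivial; try lra.
      + intros u Hu; apply (continuous_opp g), Hcont, Hu.
      + intros u Hu; specialize (Hne u Hu); lra. }
  destruct (in_itv_two_points a b Hab) as [s0 [_ [Hs0 _]]].
  destruct (Rdichotomy _ _ (Hne s0 Hs0)) as [H0 | H0]; [right | left];
    intros s Hs; destruct (Rdichotomy _ _ (Hne s Hs)) as [H | H]; trivial;
    exfalso; [apply (Hopp s0 s) | apply (Hopp s s0)]; trivial.
Qed.

(** * Behaviour of the angular momentum at a pole *)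

Lemma angular_momentum_cart (xi : R -> R3) (s : R) :
  angular_momentum xi s
  = Derive (fun t => cx (xi t)) s * cy (xi s)
    - cx (xi s) * Derive (fun t => cy (xi t)) s.
Proof.
  unfold angular_momentum, det3, velocity, e3, cx, cy, cz; simpl; ring.
Qed.

(* Near a common zero of [X] and [Y] the left-hand side is [o(t - s)] by the mean
   value theorem, while the right-hand side is of exact order [t - s]. *)
Lemma no_common_zero (k : R) (X Y : R -> R) (s : R) :
  0 < k <= 1 ->
  locally s (fun t => ex_derive X t /\ ex_derive Y t) ->
  continuous (Derive X) s -> continuous (Derive Y) s ->
  locally s (fun t => (Derive X t * Y t - X t * Derive Y t) ^ 2
                      = k ^ 2 * (X t ^ 2 + Y t ^ 2)) ->
  Derive X s ^ 2 + Derive Y s ^ 2 = 1 ->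
  X s = 0 -> Y s = 0 -> False.
Proof.
  intros Hk Hex HcX HcY HK Hunit HX0 HY0.
  (* With this tolerance the six error terms in [Hdet] sum to at most [6 k / 16], whose square is
     below the lower bound [3 / 4 * k ^ 2]. *)
  assert (Hd : 0 < k / 16) by lra.
  set (d := mkposreal _ Hd).
  assert (HbX := proj1 (filterlim_locally _ _) HcX d).
  assert (HbY := proj1 (filterlim_locally _ _) HcY d).
  destruct (filter_and _ _ Hex (filter_and _ _ HK (filter_and _ _ HbX HbY)))
    as [r Hr].
  (* Halving [r] puts the closed segment inside the open ball. *)
  assert (Hr' : forall t, s <= t <= s + r / 2 ->
            (ex_derive X t /\ ex_derive Y t)
            /\ (Derive X t * Y t - X t * Derive Y t) ^ 2
               = k ^ 2 * (X t ^ 2 + Y t ^ 2)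
            /\ Rabs (Derive X t - Derive X s) < k / 16
            /\ Rabs (Derive Y t - Derive Y s) < k / 16).
  { intros t Ht; apply Hr; change (Rabs (t - s) < r).
    assert (Hr0 := cond_pos r); apply Rabs_def1; lra. }
  clear Hr; assert (Hr0 := cond_pos r).
  assert (Hmvt : forall f : R -> R, f s = 0 ->
             (forall t, s <= t <= s + r / 2 -> ex_derive f t) ->
             exists c, s <= c <= s + r / 2
                       /\ f (s + r / 2) = Derive f c * (r / 2)).
  { intros f Hf0 Hf.
    destruct (MVT_gen f s (s + r / 2) (Derive f)) as [c [Hc Heq]].
    - rewrite Rmin_left, Rmax_right by lra; intros t Ht.
      apply Derive_correct, Hf; lra.
    - rewrite Rmin_left, Rmax_right by lra; intros t Ht.
      apply continuity_pt_filterlim, (@ex_derive_continuous R_AbsRing R_NormedModule f t), Hf, Ht.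
    - rewrite Rmin_left, Rmax_right in Hc by lra.
      exists c; split; trivial; rewrite Hf0 in Heq; lra. }
  (* The intermediate points for [X] and [Y] differ, but the derivatives at both are close to those
     at [s]. *)
  destruct (Hmvt X HX0) as [c1 [Hc1 E1]]; [intros t Ht; apply (Hr' t Ht) | ].
  destruct (Hmvt Y HY0) as [c2 [Hc2 E2]]; [intros t Ht; apply (Hr' t Ht) | ].
  destruct (Hr' (s + r / 2)) as [_ [HKt [Hx Hy]]]; [lra | ].
  destruct (Hr' c1 Hc1) as [_ [_ [Hx1 _]]].
  destruct (Hr' c2 Hc2) as [_ [_ [_ Hy2]]].
  rewrite E1, E2 in HKt.
  apply Rabs_def2 in Hx; apply Rabs_def2 in Hy;
    apply Rabs_def2 in Hx1; apply Rabs_def2 in Hy2.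
  revert HKt Hx Hy Hx1 Hy2 Hunit.
  generalize (Derive X (s + r / 2)) (Derive Y (s + r / 2))
    (Derive X c1) (Derive Y c2) (Derive X s) (Derive Y s).
  intros p q p1 q2 u v HKt Hp Hq Hp1 Hq2 Hunit.
  assert (HK' : (p * q2 - p1 * q) ^ 2 = k ^ 2 * (p1 ^ 2 + q2 ^ 2)).
  { apply Rmult_eq_reg_r with ((r / 2) ^ 2); [ | nra].
    transitivity ((p * (q2 * (r / 2)) - p1 * (r / 2) * q) ^ 2); [ring | ].
    simpl in HKt |- *; lra. }
  assert (Hu : -1 <= u <= 1) by nra.
  assert (Hv : -1 <= v <= 1) by nra.
  assert (Hb : forall m n, -(k / 16) < m < k / 16 -> -1 <= n <= 1 ->
                           -(k / 16) <= m * n <= k / 16)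
    by (intros m n Hm Hn; split; nra).
  (* Expanding around the unit vector [(u, v)], the cross terms cost at most
     [4 * (k / 16) <= 1 / 4]. *)
  assert (Hnorm : 3 / 4 <= p1 ^ 2 + q2 ^ 2).
  { assert (B1 := Hb (p1 - u) u ltac:(lra) Hu).
    assert (B2 := Hb (q2 - v) v ltac:(lra) Hv).
    assert (S1 := pow2_ge_0 (p1 - u)); assert (S2 := pow2_ge_0 (q2 - v)).
    lra. }
  assert (Hlow : 3 / 4 * k ^ 2 <= (p * q2 - p1 * q) ^ 2) by (rewrite HK'; nra).
  assert (Hdet : -(6 / 16 * k) <= p * q2 - p1 * q <= 6 / 16 * k).
  { replace (p * q2 - p1 * q)
      with ((p - u) * (q2 - v) - (p1 - u) * (q - v)
            + (p - u) * v + u * (q2 - v) - (p1 - u) * v - u * (q - v)) by ring.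
    assert (B1 := Hb (p - u) (q2 - v) ltac:(lra) ltac:(lra)).
    assert (B2 := Hb (p1 - u) (q - v) ltac:(lra) ltac:(lra)).
    assert (B3 := Hb (p - u) v ltac:(lra) ltac:(lra)).
    assert (B4 := Hb (q2 - v) u ltac:(lra) ltac:(lra)).
    assert (B5 := Hb (p1 - u) v ltac:(lra) ltac:(lra)).
    assert (B6 := Hb (q - v) u ltac:(lra) ltac:(lra)).
    lra. }
  nra.
Qed.

(** A continuous derivative without zeros keeps its sign; the decreasing case is the increasing one
    for [- z]. Both directions of the theorem start from this dichotomy. *)
Lemma z_monotone (a b : Rbar) (xi : R -> R3) :
  Rbar_lt a b -> arclength_spherical_curve a b xi ->
  (forall s, in_itv a b s -> Derive (fun t => cz (xi t)) s <> 0) ->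
  (z_increasing a b xi
   /\ forall s, in_itv a b s -> 0 < Derive (fun t => cz (xi t)) s)
  \/ (z_decreasing a b xi
      /\ forall s, in_itv a b s -> Derive (fun t => cz (xi t)) s < 0).
Proof.
  intros Hab Hxi Hne.
  assert (Hex : forall s, in_itv a b s -> ex_derive (fun t => cz (xi t)) s)
    by (intros s Hs; apply (Hxi s Hs)).
  destruct (constant_sign_on_itv a b (Derive (fun t => cz (xi t)))) as [H | H];
    trivial; [intros s Hs; apply (Hxi s Hs) | left | right]; split; trivial;
    intros s t [Hs _] [_ Ht] Hst.
  - apply (incr_function (fun t => cz (xi t)) a b
             (Derive (fun t => cz (xi t)))); trivial.
    + intros u Ha Hb; now apply Derive_correct, Hex.
    + intros u Ha Hb; now apply H.
  - apply Ropp_lt_cancel.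
    apply (incr_function (fun t => - cz (xi t)) a b
             (fun t => - Derive (fun t => cz (xi t)) t)); trivial.
    + intros u Ha Hb; apply (is_derive_opp (fun t => cz (xi t))).
      now apply Derive_correct, Hex.
    + intros u Ha Hb; apply Ropp_0_gt_lt_contravar; now apply H.
Qed.

(** * The latitude, its derivative, and the integral of the secant *)

Lemma latitude_trig (p : R3) :
  dot p p = 1 ->
  0 <= cos (latitude p)
  /\ cos (latitude p) ^ 2 = cx p ^ 2 + cy p ^ 2
  /\ sin (latitude p) = cz p.
Proof.
  unfold latitude, dot; intros Hp.
  assert (Hz : -1 <= cz p <= 1) by nra.
  rewrite cos_asin, sin_asin by trivial; repeat split.
  - apply sqrt_pos.
  - rewrite pow2_sqrt; unfold Rsqr; nra.
Qed.

Lemma is_derive_asin (x : R) : -1 < x < 1 -> is_derive asin x (/ cos (asin x)).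
Proof.
  intros Hx; apply is_derive_Reals; rewrite cos_asin by lra.
  replace (/ sqrt (1 - x²)) with (derive_pt asin x (derivable_pt_asin x Hx)).
  - now destruct (derivable_pt_asin x Hx).
  - rewrite derive_pt_asin; field.
    apply Rgt_not_eq, sqrt_lt_R0; unfold Rsqr; nra.
Qed.

(** Positivity of [cos (latitude p)] is the form in which being off the poles is expressed; it puts
    [cz p] where [asin] is differentiable. *)
Lemma cos_latitude_pos (p : R3) :
  dot p p = 1 -> 0 < cos (latitude p) ->
  -1 < cz p < 1 /\ - (PI / 2) < latitude p < PI / 2.
Proof.
  intros Hp Hc; destruct (latitude_trig p Hp) as [_ [Hc2 _]].
  assert (Hz : -1 < cz p < 1).
  { unfold dot in Hp; assert (0 < cx p ^ 2 + cy p ^ 2)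
      by (rewrite <- Hc2; now apply pow_lt). split; nra. }
  split; trivial; now apply asin_bound_lt.
Qed.

Lemma is_derive_latitude (xi : R -> R3) (s : R) :
  dot (xi s) (xi s) = 1 -> 0 < cos (latitude (xi s)) ->
  ex_derive (fun t => cz (xi t)) s ->
  is_derive (fun t => latitude (xi t)) s
    (Derive (fun t => cz (xi t)) s / cos (latitude (xi s))).
Proof.
  intros Hp Hc Hex; destruct (cos_latitude_pos _ Hp Hc) as [Hz _].
  apply (is_derive_comp asin (fun t => cz (xi t))).
  - now apply is_derive_asin.
  - now apply Derive_correct.
Qed.

(** This is the ordinate of the Mercator projection, in which loxodromes are straight lines. *)
Definition inverse_gudermannian (phi : R) : R := RInt (fun u => / cos u) 0 phi.

Lemma is_derive_inverse_gudermannian (phi : R) :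
  - (PI / 2) < phi < PI / 2 ->
  is_derive inverse_gudermannian phi (/ cos phi).
Proof.
  intros Hphi.
  assert (Hcont : forall u, - (PI / 2) < u < PI / 2 ->
                            continuous (fun u => / cos u) u).
  { intros u Hu; apply (@ex_derive_continuous R_AbsRing R_NormedModule).
    auto_derive; apply Rgt_not_eq, cos_gt_0; lra. }
  apply (is_derive_RInt (fun u => / cos u) inverse_gudermannian 0 phi).
  (* The integral must exist for every upper bound near [phi]; the segment from 0 to such a bound
     avoids the zeros of the cosine. *)
  - assert (Hloc : locally phi (in_itv (- (PI / 2)) (PI / 2)))
      by now apply locally_in_itv.
    revert Hloc; apply filter_imp; intros u [Hu1 Hu2]; simpl in Hu1, Hu2.
    apply (@RInt_correct R_CompleteNormedModule).
    apply (@ex_RInt_continuous R_CompleteNormedModule).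
    intros v Hv; apply Hcont; revert Hv.
    assert (Hpi := PI_RGT_0).
    unfold Rmin, Rmax; destruct (Rle_dec 0 u); lra.
  - now apply Hcont.
Qed.

(** * Angles on the unit circle and rotations about the z-axis *)

Lemma unit_circle_angle (u v : R) :
  u ^ 2 + v ^ 2 = 1 -> exists theta, u = cos theta /\ v = sin theta.
Proof.
  intros H; assert (Hu : -1 <= u <= 1) by nra.
  assert (Hs : sqrt (1 - u²) = Rabs v).
  { rewrite <- sqrt_Rsqr_abs; f_equal; unfold Rsqr; lra. }
  (* [acos] reaches only the upper half circle; on the lower half its opposite is the angle. *)
  destruct (Rle_dec 0 v) as [Hv | Hv].
  - exists (acos u); rewrite cos_acos, sin_acos, Hs, Rabs_pos_eq by trivial; auto.
  - exists (- acos u).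
    rewrite cos_neg, sin_neg, cos_acos, sin_acos, Hs, Rabs_left by lra.
    split; ring.
Qed.

Lemma rot_z_geo (theta phi lam : R) :
  rot_z theta (geo phi lam) = geo phi (lam + theta).
Proof.
  unfold rot_z, geo, cx, cy, cz; simpl.
  rewrite cos_plus, sin_plus; f_equal; f_equal; ring.
Qed.

(** * Position, velocity and derivatives of quotients *)

Lemma dot_velocity (p : R3) (xi : R -> R3) (s : R) :
  dot p (velocity xi s)
  = cx p * Derive (fun t => cx (xi t)) s + cy p * Derive (fun t => cy (xi t)) s
    + cz p * Derive (fun t => cz (xi t)) s.
Proof. reflexivity. Qed.

Lemma dot_velocity_velocity (xi : R -> R3) (s : R) :
  dot (velocity xi s) (velocity xi s)
  = Derive (fun t => cx (xi t)) s ^ 2 + Derive (fun t => cy (xi t)) s ^ 2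
    + Derive (fun t => cz (xi t)) s ^ 2.
Proof. unfold dot, velocity, cx, cy, cz; simpl; ring. Qed.

(** Differentiate [|xi|^2 = 1], which holds in a neighbourhood of [s] because the interval is
    open. *)
Lemma dot_xi_velocity (a b : Rbar) (xi : R -> R3) (s : R) :
  arclength_spherical_curve a b xi -> in_itv a b s ->
  dot (xi s) (velocity xi s) = 0.
Proof.
  intros Hxi Hs.
  assert (Hconst : Derive (fun t => dot (xi t) (xi t)) s = Derive (fun _ => 1) s).
  { apply Derive_ext_loc; generalize (locally_in_itv a b s Hs).
    apply filter_imp; intros t Ht; apply (Hxi t Ht). }
  rewrite Derive_const in Hconst.
  destruct (Hxi s Hs) as [_ [[Hx _] [[Hy _] [[Hz _] _]]]].
  assert (Hd : is_derive (fun t => dot (xi t) (xi t)) s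
                 (2 * dot (xi s) (velocity xi s))).
  { assert (Hsq : forall f : R -> R, ex_derive f s ->
               is_derive (fun t => f t * f t) s (2 * (f s * Derive f s)))
      by (intros f Hf; auto_derive; [tauto | change (fun x => f x) with f; ring]).
    rewrite dot_velocity, !Rmult_plus_distr_l.
    apply (is_derive_plus (fun t => cx (xi t) * cx (xi t) + cy (xi t) * cy (xi t))
             (fun t => cz (xi t) * cz (xi t)));
      [apply (is_derive_plus (fun t => cx (xi t) * cx (xi t))
                (fun t => cy (xi t) * cy (xi t))) | ];
      now apply (Hsq (fun t => _ (xi t))). }
  apply (Rmult_eq_reg_l 2); [ | lra].
  rewrite Rmult_0_r, <- Hconst; symmetry; now apply is_derive_unique.
Qed.

Lemma is_derive_div_cos (f phi : R -> R) (s d : R) :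
  ex_derive f s -> is_derive phi s d -> cos (phi s) <> 0 ->
  is_derive (fun t => f t / cos (phi t)) s
    ((Derive f s * cos (phi s) + f s * (sin (phi s) * d)) / cos (phi s) ^ 2).
Proof.
  intros Hf Hphi Hc.
  assert (Hex : ex_derive phi s) by now exists d.
  auto_derive; [tauto | ].
  change (fun x => f x) with f; change (fun x => phi x) with phi.
  rewrite (is_derive_unique phi s d Hphi); now field.
Qed.

(** * Constancy from a zero derivative, and pairs rotating at a known rate *)

Lemma derive_0_constant (a b : Rbar) (f : R -> R) (s t : R) :
  (forall u, in_itv a b u -> is_derive f u 0) ->
  in_itv a b s -> in_itv a b t -> f s = f t.
Proof.
  intros Hf Hs Ht.
  destruct (Rtotal_order s t) as [H | [-> | H]]; [ | easy | symmetry];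
    apply (eq_is_derive f); trivial; intros u Hu; apply Hf.
  - now apply in_itv_between with s t.
  - now apply in_itv_between with t s.
Qed.

(* In the frame turning at angle [L] the pair [(p, q)] is constant. *)
Lemma rotating_unit_pair (a b : Rbar) (p q L w : R -> R) (s0 : R) :
  (forall s, in_itv a b s ->
     is_derive p s (- (w s * q s)) /\ is_derive q s (w s * p s)
     /\ is_derive L s (w s)) ->
  in_itv a b s0 -> p s0 ^ 2 + q s0 ^ 2 = 1 ->
  exists theta, forall s, in_itv a b s ->
    p s = cos (L s + theta) /\ q s = sin (L s + theta).
Proof.
  intros Hder Hs0 Hunit.
  set (u := fun s => p s * cos (L s) + q s * sin (L s)).
  set (v := fun s => q s * cos (L s) - p s * sin (L s)).
  assert (Hcs : forall s, sin (L s) * sin (L s) + cos (L s) * cos (L s) = 1)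
    by (intros s; apply sin2_cos2).
  destruct (unit_circle_angle (u s0) (v s0)) as [theta [Hu Hv]].
  { unfold u, v.
    transitivity ((p s0 ^ 2 + q s0 ^ 2)
                  * (sin (L s0) * sin (L s0) + cos (L s0) * cos (L s0)));
      [ring | rewrite Hunit, Hcs; ring]. }
  assert (Huv : forall s, in_itv a b s ->
                  is_derive u s 0 /\ is_derive v s 0).
  { intros s Hs; destruct (Hder s Hs) as [Hp [Hq HL]].
    assert (Ep : ex_derive p s) by (eexists; exact Hp).
    assert (Eq : ex_derive q s) by (eexists; exact Hq).
    assert (EL : ex_derive L s) by (eexists; exact HL).
    apply is_derive_unique in Hp; apply is_derive_unique in Hq;
      apply is_derive_unique in HL.
    unfold u, v; split; auto_derive; try tauto;
      change (fun x => p x) with p; change (fun x => q x) with q;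
      change (fun x => L x) with L; rewrite Hp, Hq, HL; ring. }
  exists theta; intros s Hs.
  assert (Hus : u s = cos theta).
  { rewrite <- Hu; apply (derive_0_constant a b); trivial; apply Huv. }
  assert (Hvs : v s = sin theta).
  { rewrite <- Hv; apply (derive_0_constant a b); trivial; apply Huv. }
  rewrite cos_plus, sin_plus, <- Hus, <- Hvs; unfold u, v; split.
  - transitivity (p s * (sin (L s) * sin (L s) + cos (L s) * cos (L s)));
      [rewrite Hcs | ]; ring.
  - transitivity (q s * (sin (L s) * sin (L s) + cos (L s) * cos (L s)));
      [rewrite Hcs | ]; ring.
Qed.

(** * Curves with the prescribed angular momentum *)

Section PrescribedMomentum.

Variables (alpha : R) (a b : Rbar) (xi : R -> R3).
Hypothesis halpha : 0 < alpha < PI / 2.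
Hypothesis hxi : arclength_spherical_curve a b xi.
Hypothesis hK : has_angular_momentum a b xi (fun phi => - cos alpha * cos phi).

(* [|xi|^2 |xi'|^2 = 1] gives [K^2 + z'^2 = 1 - z^2], also at the poles. *)
Lemma z_speed (s : R) :
  in_itv a b s ->
  Derive (fun t => cz (xi t)) s ^ 2 = (sin alpha * cos (latitude (xi s))) ^ 2.
Proof.
  intros Hs.
  assert (HK := hK s Hs); rewrite angular_momentum_cart in HK.
  assert (Horth := dot_xi_velocity a b xi s hxi Hs).
  destruct (hxi s Hs) as [Hp [_ [_ [_ Hv]]]].
  destruct (latitude_trig _ Hp) as [_ [Hc _]].
  assert (Hsc := sin2_cos2 alpha); unfold Rsqr in Hsc.
  rewrite dot_velocity in Horth; rewrite dot_velocity_velocity in Hv.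
  unfold dot in Hp; revert HK Horth Hp Hv Hc.
  generalize (Derive (fun t => cx (xi t)) s) (Derive (fun t => cy (xi t)) s)
    (Derive (fun t => cz (xi t)) s) (cx (xi s)) (cy (xi s)) (cz (xi s))
    (cos (latitude (xi s))).
  intros x' y' z' x y z c HK Horth Hp Hv Hc.
  assert (HK2 : (x' * y - x * y') ^ 2 = (cos alpha) ^ 2 * c ^ 2)
    by (rewrite HK; ring).
  assert (Hr2 : (x * x' + y * y') ^ 2 = z ^ 2 * z' ^ 2)
    by (replace (x * x' + y * y') with (- (z * z')) by lra; ring).
  (* Lagrange's identity for the plane vectors [(x, y)] and [(x', y')], whose squared norms come
     from the sphere and the unit speed. *)
  assert (Hlag : (x' * y - x * y') ^ 2 + (x * x' + y * y') ^ 2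
                 = (1 - z ^ 2) * (1 - z' ^ 2)).
  { replace (1 - z ^ 2) with (x ^ 2 + y ^ 2) by (clear - Hp; lra).
    replace (1 - z' ^ 2) with (x' ^ 2 + y' ^ 2) by (clear - Hv; lra). ring. }
  replace (z' ^ 2) with (1 - z ^ 2 - (cos alpha) ^ 2 * c ^ 2)
    by (clear - HK2 Hr2 Hlag; lra).
  replace (1 - z ^ 2) with (c ^ 2) by (clear - Hp Hc; lra).
  replace ((sin alpha * c) ^ 2) with ((sin alpha * sin alpha) * c ^ 2) by ring.
  replace (sin alpha * sin alpha) with (1 - cos alpha * cos alpha) by lra.
  ring.
Qed.

Lemma cos_alpha_bounds : 0 < cos alpha <= 1.
Proof.
  split; [apply cos_gt_0; lra | apply COS_bound].
Qed.

(** At a pole [z_speed] forces [z' = 0], so [(x', y')] has norm one while [x] and [y] both vanish;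
    [no_common_zero] with [k = cos alpha] excludes this. *)
Lemma avoids_poles (s : R) : in_itv a b s -> 0 < cos (latitude (xi s)).
Proof.
  intros Hs; destruct (hxi s Hs) as [Hp [[_ Hx] [[_ Hy] [_ Hv]]]].
  destruct (latitude_trig _ Hp) as [Hc0 [Hc _]].
  destruct Hc0 as [Hc0 | Hc0]; trivial; exfalso.
  assert (Hz' := z_speed s Hs); rewrite <- Hc0 in Hz', Hc.
  apply (no_common_zero (cos alpha) (fun t => cx (xi t)) (fun t => cy (xi t)) s);
    trivial; try nra.
  - exact cos_alpha_bounds.
  - generalize (locally_in_itv a b s Hs); apply filter_imp; intros t Ht.
    split; apply (hxi t Ht).
  - generalize (locally_in_itv a b s Hs); apply filter_imp; intros t Ht.
    assert (HK := hK t Ht); rewrite angular_momentum_cart in HK.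
    rewrite HK.
    destruct (hxi t Ht) as [Hpt _]; destruct (latitude_trig _ Hpt) as [_ [Hct _]].
    rewrite <- Hct; ring.
  - rewrite dot_velocity_velocity in Hv; nra.
Qed.

Lemma z_speed_ne_0 (s : R) :
  in_itv a b s -> Derive (fun t => cz (xi t)) s <> 0.
Proof.
  intros Hs H0; assert (Hz := z_speed s Hs); rewrite H0 in Hz.
  assert (Hsin : 0 < sin alpha) by (apply sin_gt_0; lra).
  assert (Hm := Rmult_lt_0_compat _ _ Hsin (avoids_poles s Hs)).
  nra.
Qed.

Lemma z_speed_pos (s : R) :
  in_itv a b s -> 0 < Derive (fun t => cz (xi t)) s ->
  Derive (fun t => cz (xi t)) s = sin alpha * cos (latitude (xi s)).
Proof.
  intros Hs Hpos; assert (Hz := z_speed s Hs).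
  assert (Hsin : 0 < sin alpha) by (apply sin_gt_0; lra).
  assert (Hm := Rmult_lt_0_compat _ _ Hsin (avoids_poles s Hs)).
  nra.
Qed.

(** * The case of increasing [z], to which [mirror_equator] reduces the other *)

Hypothesis hpos : forall s, in_itv a b s -> 0 < Derive (fun t => cz (xi t)) s.

(** A candidate only: the longitude of the loxodrome through (1, 0, 0) at the latitude of [xi s]. It
    will differ from a longitude of [xi s] by a constant. *)
Definition loxodrome_longitude (s : R) : R :=
  cos alpha / sin alpha * inverse_gudermannian (latitude (xi s)).

Lemma is_derive_latitude_arclength (s : R) :
  in_itv a b s -> is_derive (fun t => latitude (xi t)) s (sin alpha).
Proof.
  intros Hs; assert (Hc := avoids_poles s Hs).
  destruct (hxi s Hs) as [Hp [_ [_ [[Hz _] _]]]].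
  replace (sin alpha)
    with (Derive (fun t => cz (xi t)) s / cos (latitude (xi s))).
  - now apply is_derive_latitude.
  - rewrite z_speed_pos by auto; field; lra.
Qed.

Lemma is_derive_loxodrome_longitude (s : R) :
  in_itv a b s ->
  is_derive loxodrome_longitude s (cos alpha / cos (latitude (xi s))).
Proof.
  intros Hs; assert (Hc := avoids_poles s Hs).
  assert (Hsin : 0 < sin alpha) by (apply sin_gt_0; lra).
  destruct (hxi s Hs) as [Hp _]; destruct (cos_latitude_pos _ Hp Hc) as [_ Hphi].
  replace (cos alpha / cos (latitude (xi s)))
    with (cos alpha / sin alpha * (sin alpha * / cos (latitude (xi s))))
    by (field; lra).
  apply (is_derive_scal (fun t => inverse_gudermannian (latitude (xi t)))).
  apply (is_derive_comp inverse_gudermannian (fun t => latitude (xi t))).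
  - now apply is_derive_inverse_gudermannian.
  - now apply is_derive_latitude_arclength.
Qed.

(* [x / cos phi] and [y / cos phi] rotate at the rate [cos alpha / cos phi]. *)
Lemma is_derive_equatorial (s : R) :
  in_itv a b s ->
  is_derive (fun t => cx (xi t) / cos (latitude (xi t))) s
    (- (cos alpha * cy (xi s) / cos (latitude (xi s)) ^ 2))
  /\ is_derive (fun t => cy (xi t) / cos (latitude (xi t))) s
    (cos alpha * cx (xi s) / cos (latitude (xi s)) ^ 2).
Proof.
  intros Hs; assert (Hc := avoids_poles s Hs).
  assert (HK := hK s Hs); rewrite angular_momentum_cart in HK.
  assert (Horth := dot_xi_velocity a b xi s hxi Hs).
  assert (Hz := z_speed_pos s Hs (hpos s Hs)).
  assert (Hphi := is_derive_latitude_arclength s Hs).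
  destruct (hxi s Hs) as [Hp [[Hx _] [[Hy _] _]]].
  destruct (latitude_trig _ Hp) as [_ [Hc2 Hsin]].
  rewrite dot_velocity, Hz in Horth.
  clear Hsin.
  assert (Hc' : cos (latitude (xi s)) <> 0) by lra.
  assert (Hqx := is_derive_div_cos (fun t => cx (xi t)) _ s _ Hx Hphi Hc').
  assert (Hqy := is_derive_div_cos (fun t => cy (xi t)) _ s _ Hy Hphi Hc').
  cbv beta in Hqx, Hqy; destruct (latitude_trig _ Hp) as [_ [_ Hsin]].
  rewrite Hsin in Hqx, Hqy.
  split; [evar_last; [exact Hqx | ] | evar_last; [exact Hqy | ]];
    clear Hqx Hqy Hphi Hx Hy Hz Hsin Hp; revert HK Horth Hc2 Hc';
    generalize (Derive (fun t => cx (xi t)) s) (Derive (fun t => cy (xi t)) s)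
      (cx (xi s)) (cy (xi s)) (cz (xi s)) (cos (latitude (xi s)));
    intros x' y' x y z c HK Horth Hc2 Hc'; unfold Rdiv;
    rewrite <- ?Ropp_mult_distr_l, ?Ropp_mult_distr_l; f_equal;
    apply (Rmult_eq_reg_r c); trivial.
  (* With [c ^ 2 = x ^ 2 + y ^ 2], the vector [(x', y')] is recovered from its radial and angular
     parts: [x' (x^2 + y^2) = x (x x' + y y') + y (x' y - x y')], and similarly for [y']. *)
  - transitivity (x' * (x ^ 2 + y ^ 2) + x * (z * sin alpha) * c);
      [rewrite <- Hc2; ring | ].
    transitivity (x * (x * x' + y * y' + z * (sin alpha * c))
                  + y * (x' * y - x * y')); [ring | ].
    rewrite Horth, HK; ring.
  - transitivity (y' * (x ^ 2 + y ^ 2) + y * (z * sin alpha) * c);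
      [rewrite <- Hc2; ring | ].
    transitivity (y * (x * x' + y * y' + z * (sin alpha * c))
                  - x * (x' * y - x * y')); [ring | ].
    rewrite Horth, HK; ring.
Qed.

(** The pair [(x, y) / cos phi] lies on the unit circle at [s0] and turns at the rate at which
    [loxodrome_longitude] grows, so one angle [theta] serves for the whole interval. *)
Lemma increasing_rotated_loxodrome (s0 : R) :
  in_itv a b s0 -> rotated_loxodrome alpha a b xi.
Proof.
  intros Hs0.
  destruct (rotating_unit_pair a b
              (fun s => cx (xi s) / cos (latitude (xi s)))
              (fun s => cy (xi s) / cos (latitude (xi s)))
              loxodrome_longitude
              (fun s => cos alpha / cos (latitude (xi s))) s0)
    as [theta Htheta]; trivial.
  { intros s Hs; assert (Hc := avoids_poles s Hs).
    destruct (is_derive_equatorial s Hs) as [Hx Hy].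
    split; [ | split].
    - evar_last; [exact Hx | field; lra].
    - evar_last; [exact Hy | field; lra].
    - now apply is_derive_loxodrome_longitude. }
  { assert (Hc := avoids_poles s0 Hs0); destruct (hxi s0 Hs0) as [Hp _].
    destruct (latitude_trig _ Hp) as [_ [Hc2 _]].
    transitivity ((cx (xi s0) ^ 2 + cy (xi s0) ^ 2) / cos (latitude (xi s0)) ^ 2);
      [ | rewrite <- Hc2]; field; lra. }
  (* This formula yields both the coordinates for the loxodrome equation and the rotation. *)
  assert (Hgeo : forall s, in_itv a b s ->
            xi s = geo (latitude (xi s)) (loxodrome_longitude s + theta)).
  { intros s Hs; destruct (Htheta s Hs) as [Hx Hy].
    assert (Hc := avoids_poles s Hs); destruct (hxi s Hs) as [Hp _].
    destruct (latitude_trig _ Hp) as [_ [_ Hz]].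
    unfold geo; rewrite <- Hx, <- Hy, Hz.
    destruct (xi s) as [[x y] z]; unfold cx, cy, cz in *; simpl in *.
    f_equal; f_equal; field; lra. }
  split.
  - exists (fun s => latitude (xi s)), (fun s => loxodrome_longitude s + theta).
    intros s Hs; assert (Hc := avoids_poles s Hs).
    assert (Hsin : 0 < sin alpha) by (apply sin_gt_0; lra).
    assert (Hphi := is_derive_latitude_arclength s Hs).
    assert (HL : is_derive (fun t => loxodrome_longitude t + theta) s
                   (cos alpha / cos (latitude (xi s)))).
    { evar_last; [apply (is_derive_plus loxodrome_longitude (fun _ => theta))
                 | apply Rplus_0_r].
      - now apply is_derive_loxodrome_longitude.
      - apply (@is_derive_const R_AbsRing R_NormedModule). }
    destruct (hxi s Hs) as [Hp _].
    repeat split.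
    1, 2: now apply (cos_latitude_pos _ Hp Hc).
    + now apply Hgeo.
    + now exists (sin alpha).
    + now exists (cos alpha / cos (latitude (xi s))).
    + apply is_derive_unique in HL; apply is_derive_unique in Hphi.
      change (Derive (fun t => loxodrome_longitude t + theta) s
              = cos alpha / cos (latitude (xi s))) in HL.
      change (Derive (fun t => latitude (xi t)) s = sin alpha) in Hphi.
      rewrite HL, Hphi; field; lra.
  - exists theta; intros s Hs; unfold loxodrome_point; rewrite rot_z_geo.
    now apply Hgeo.
Qed.

End PrescribedMomentum.

(** * Velocity and angular momentum of a given loxodrome *)

Lemma geo_velocity (xi : R -> R3) (phi lam : R -> R) (s : R) :
  locally s (fun t => xi t = geo (phi t) (lam t)) ->
  ex_derive phi s -> ex_derive lam s ->
  velocity xi s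
  = (- sin (phi s) * Derive phi s * cos (lam s)
       - cos (phi s) * sin (lam s) * Derive lam s,
     - sin (phi s) * Derive phi s * sin (lam s)
       + cos (phi s) * cos (lam s) * Derive lam s,
     cos (phi s) * Derive phi s).
Proof.
  intros Heq Hphi Hlam.
  assert (Hcoord : forall (c : R3 -> R) d,
             is_derive (fun t => c (geo (phi t) (lam t))) s d ->
             Derive (fun t => c (xi t)) s = d).
  { intros c d Hd; apply is_derive_unique; revert Hd.
    apply is_derive_ext_loc; revert Heq; apply filter_imp.
    intros t ->; reflexivity. }
  unfold velocity; f_equal;
    [f_equal; [apply (Hcoord cx) | apply (Hcoord cy)] | apply (Hcoord cz)];
    unfold geo, cx, cy, cz; simpl; auto_derive; try tauto;
    change (fun x => phi x) with phi; change (fun x => lam x) with lam; ring.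
Qed.

(** Here [d] is the derivative of the latitude. Unit speed reads [d^2 (1 + cot^2 alpha) = 1], which
    fixes [d] up to sign; the sign depends on the orientation of the curve. *)
Lemma loxodrome_velocity (alpha : R) (a b : Rbar) (xi : R -> R3) (s : R) :
  0 < alpha < PI / 2 -> arclength_spherical_curve a b xi ->
  loxodrome alpha a b xi -> in_itv a b s ->
  0 < cos (latitude (xi s))
  /\ exists d, d ^ 2 = sin alpha ^ 2
       /\ Derive (fun t => cz (xi t)) s = cos (latitude (xi s)) * d
       /\ angular_momentum xi s
          = - (cos alpha / sin alpha * d * cos (latitude (xi s))).
Proof.
  intros Halpha Hxi [phi [lam Hlox]] Hs.
  destruct (Hlox s Hs) as [Hrange [Hpt [Hphi [Hlam Heq]]]].
  assert (Hsin : 0 < sin alpha) by (apply sin_gt_0; lra).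
  assert (Hsc := sin2_cos2 alpha); unfold Rsqr in Hsc.
  assert (Hlat : latitude (xi s) = phi s)
    by (rewrite Hpt; apply asin_sin; lra).
  assert (Hc : 0 < cos (phi s)) by now apply cos_gt_0.
  assert (Hloc : locally s (fun t => xi t = geo (phi t) (lam t))).
  { generalize (locally_in_itv a b s Hs); apply filter_imp.
    intros t Ht; apply (Hlox t Ht). }
  assert (Hvel := geo_velocity xi phi lam s Hloc Hphi Hlam).
  destruct (Hxi s Hs) as [_ [_ [_ [_ Hspeed]]]].
  assert (HL := sin2_cos2 (lam s)); assert (HP := sin2_cos2 (phi s)).
  unfold Rsqr in HL, HP.
  rewrite Hlat; split; trivial; exists (Derive phi s); repeat split.
  - rewrite Hvel in Hspeed; unfold dot, cx, cy, cz in Hspeed; simpl in Hspeed.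
    rewrite Heq in Hspeed.
    assert (Hone : Derive phi s ^ 2 + (cos alpha / sin alpha * Derive phi s) ^ 2 = 1).
    { rewrite <- Hspeed.
      (* The sums [sin^2 + cos^2] are kept visible so that [HL] and [HP] can turn them into 1. *)
      transitivity (Derive phi s ^ 2
        * (sin (phi s) * sin (phi s)
             * (sin (lam s) * sin (lam s) + cos (lam s) * cos (lam s))
           + cos (phi s) * cos (phi s))
        + (cos alpha / sin alpha * Derive phi s) ^ 2
          * (sin (lam s) * sin (lam s) + cos (lam s) * cos (lam s))).
      - rewrite HL; rewrite Rmult_1_r, HP; ring.
      - field; lra. }
    transitivity (sin alpha ^ 2
      * (Derive phi s ^ 2 + (cos alpha / sin alpha * Derive phi s) ^ 2));
      [ | rewrite Hone; ring].
    transitivity ((sin alpha * sin alpha + cos alpha * cos alpha)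
                  * Derive phi s ^ 2); [rewrite Hsc; ring | field; lra].
  - change (cz (velocity xi s) = cos (phi s) * Derive phi s).
    now rewrite Hvel.
  - rewrite angular_momentum_cart.
    change (cx (velocity xi s) * cy (xi s) - cx (xi s) * cy (velocity xi s)
            = - (cos alpha / sin alpha * Derive phi s * cos (phi s))).
    rewrite Hvel, Hpt, Heq; unfold geo, cx, cy; simpl.
    transitivity (- (cos alpha / sin alpha * Derive phi s * cos (phi s)
        * (sin (lam s) * sin (lam s) + cos (lam s) * cos (lam s))));
      [field; lra | rewrite HL; ring].
Qed.

(** * Reversal of the parameter and reflection in the equator *)

Lemma angular_momentum_reverse (xi : R -> R3) (s : R) :
  ex_derive (fun t => cx (xi t)) (- s) -> ex_derive (fun t => cy (xi t)) (- s) ->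
  angular_momentum (fun t => xi (- t)) s = - angular_momentum xi (- s).
Proof.
  intros Hx Hy; rewrite !angular_momentum_cart.
  assert (Hrev : forall f : R -> R, ex_derive f (- s) ->
             Derive (fun t => f (- t)) s = - Derive f (- s)).
  { intros f Hf; apply is_derive_unique; auto_derive; [tauto | ].
    change (fun x => f x) with f; ring. }
  rewrite (Hrev (fun t => cx (xi t))), (Hrev (fun t => cy (xi t))) by trivial.
  ring.
Qed.

Lemma in_itv_opp (a b : Rbar) (s : R) :
  in_itv (Rbar_opp b) (Rbar_opp a) s -> in_itv a b (- s).
Proof.
  intros [Hb Ha]; split; apply Rbar_opp_lt; rewrite ?Rbar_opp_involutive; simpl;
    now rewrite Ropp_involutive.
Qed.

Lemma mirror_arclength (a b : Rbar) (xi : R -> R3) :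
  arclength_spherical_curve a b xi ->
  arclength_spherical_curve a b (fun s => mirror_equator (xi s)).
Proof.
  intros Hxi s Hs; destruct (Hxi s Hs) as [Hp [Hx [Hy [[Hz Hz'] Hv]]]].
  repeat split; try apply Hx; try apply Hy.
  - rewrite <- Hp; unfold dot, mirror_equator, cx, cy, cz; simpl; ring.
  - now apply (ex_derive_opp (fun t => cz (xi t))).
  - apply continuous_ext with (fun t => - Derive (fun t => cz (xi t)) t).
    + intros t; symmetry; apply Derive_opp.
    + now apply (continuous_opp (Derive (fun t => cz (xi t)))).
  - rewrite dot_velocity_velocity in Hv |- *; rewrite <- Hv.
    unfold mirror_equator at 3; unfold cz at 1; simpl snd.
    rewrite Derive_opp; unfold mirror_equator, cx, cy; simpl; ring.
Qed.

(** The momentum involves only [x] and [y], and the cosine is even in the latitude. *)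
Lemma mirror_angular_momentum (a b : Rbar) (xi : R -> R3) (k : R) :
  has_angular_momentum a b xi (fun phi => - k * cos phi) ->
  has_angular_momentum a b (fun s => mirror_equator (xi s))
    (fun phi => - k * cos phi).
Proof.
  intros HK s Hs; specialize (HK s Hs); rewrite angular_momentum_cart in HK |- *.
  unfold latitude, mirror_equator, cz; simpl; rewrite asin_opp, cos_neg.
  exact HK.
Qed.

(** The momentum [- cos alpha * cos phi] means that the longitude increases, while on a loxodrome
    with [cot alpha > 0] latitude and longitude vary in the same sense. Hence a descending loxodrome
    acquires this momentum after reversal, whereas a descending curve with this momentum becomes a
    loxodrome after reflection. *)
Theorem corollary4p1 (alpha : R) (halpha : 0 < alpha < PI / 2)
    (a b : Rbar) (hab : Rbar_lt a b)
    (xi : R -> R3) (hxi : arclength_spherical_curve a b xi) :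
  (loxodrome alpha a b xi ->
     z_nonconstant a b xi
     /\ ((z_increasing a b xi
          /\ has_angular_momentum a b xi
               (fun phi => - cos alpha * cos phi))
         \/ (z_decreasing a b xi
             /\ has_angular_momentum (Rbar_opp b) (Rbar_opp a)
                  (fun s => xi (- s))
                  (fun phi => - cos alpha * cos phi))))
  /\
  (z_nonconstant a b xi ->
   has_angular_momentum a b xi (fun phi => - cos alpha * cos phi) ->
     (z_increasing a b xi /\ rotated_loxodrome alpha a b xi)
     \/ (z_decreasing a b xi
         /\ rotated_loxodrome alpha a b (fun s => mirror_equator (xi s)))).
Proof.
  destruct (in_itv_two_points a b hab) as [s0 [t0 [Hs0 [Ht0 Hst0]]]].
  assert (Hsin : 0 < sin alpha) by (apply sin_gt_0; lra).
  split.
  - intros Hlox.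
    assert (Hvel := fun s => loxodrome_velocity alpha a b xi s halpha hxi Hlox).
    destruct (z_monotone a b xi hab hxi) as [[Hmono Hsign] | [Hmono Hsign]].
    + intros s Hs; destruct (Hvel s Hs) as [Hc [d [Hd [-> _]]]].
      apply Rmult_integral_contrapositive_currified; nra.
    + split; [exists s0, t0; repeat split; try apply Hs0; try apply Ht0;
                apply Rlt_not_eq, Hmono; trivial | left; split; trivial].
      intros s Hs; destruct (Hvel s Hs) as [Hc [d [Hd [Hz ->]]]].
      specialize (Hsign s Hs); rewrite Hz in Hsign.
      (* The sign of [z' = cos phi * d] selects the root of [d ^ 2 = sin alpha ^ 2]. *)
      assert (Hd0 : 0 < d) by nra.
      assert (d = sin alpha) as -> by nra; field; lra.
    + split; [exists s0, t0; repeat split; try apply Hs0; try apply Ht0;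
                apply Rgt_not_eq, Hmono; trivial | right; split; trivial].
      intros s Hs; apply in_itv_opp in Hs.
      rewrite angular_momentum_reverse by apply (hxi _ Hs).
      destruct (Hvel _ Hs) as [Hc [d [Hd [Hz ->]]]].
      specialize (Hsign _ Hs); rewrite Hz in Hsign.
      assert (Hd0 : d < 0) by nra.
      assert (d = - sin alpha) as -> by nra; field; lra.
  - intros _ HK.
    destruct (z_monotone a b xi hab hxi) as [[Hmono Hsign] | [Hmono Hsign]].
    + intros s; now apply (z_speed_ne_0 alpha a b xi halpha hxi HK).
    + left; split; trivial.
      now apply increasing_rotated_loxodrome with s0.
    + right; split; trivial.
      (* The mirrored curve has the same momentum function and a positive derivative of [z]. *)
      apply increasing_rotated_loxodrome with s0; trivial.
      * now apply mirror_arclength.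
      * now apply mirror_angular_momentum.
      * intros s Hs; specialize (Hsign s Hs).
        unfold mirror_equator, cz; simpl; rewrite Derive_opp.
        unfold cz in Hsign; lra.
Qed.
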